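(* For every integer $n\geq 2$, $\kappa^1(BH_n)=\kappa^2(BH_n)=4n-4$.
   Context: The $n$-dimensional balanced hypercube $BH_n$ ($n\ge 1$) is the simple undirected graph whose vertices are the $4^n$ tuples $(a_0,a_1,\ldots,a_{n-1})$ with each $a_j\in\{0,1,2,3\}$. The vertex $(a_0,\ldots,a_{n-1})$ is adjacent to exactly the following $2n$ vertices: (1) $(a_0\pm 1 \bmod 4,\,a_1,\ldots,a_{n-1})$; (2) for each $i$ with $1\le i\le n-1$, the two vertices $(a_0\pm 1\bmod 4,\,a_1,\ldots,a_{i-1},\,a_i+(-1)^{a_0}\bmod 4,\,a_{i+1},\ldots,a_{n-1})$. For a graph $G$ and an integer $h\ge 0$, an $h$-vertex cut of $G$ is a set $F\subset V(G)$ such that $G-F$ is disconnected and every component of $G-F$ has minimum degree at least $h$. The (restricted) $h$-connectivity $\kappa^h(G)$ is the minimum cardinality of an $h$-vertex cut of $G$, if an $h$-vertex cut exists. A statement giving a value of $\kappa^h(G)$ includes the assertion that an $h$-vertex cut exists. *)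

(* Defs.v *)
From mathcomp Require Import all_boot all_order all_algebra.

Set Implicit Arguments.
Unset Strict Implicit.
Unset Printing Implicit Defensive.

Import GRing.Theory.

Record sgraph := SGraph {
  vertex :> finType;
  adj : rel vertex;
  adj_sym : symmetric adj;
  adj_irrefl : irreflexive adj
}.

(* The subgraph of G induced by S is represented by its vertex set S;
   in particular G - F is represented by ~: F. *)
Section InducedSubgraphs.
Variable G : sgraph.
Implicit Types (S F : {set G}) (x : G) (h : nat).

Definition induced_adj S : rel G :=
  [rel x y | [&& x \in S, y \in S & adj x y]].

Definition components S : {set {set G}} :=
  equivalence_partition (connect (induced_adj S)) S.

Definition disconnected S : bool := 1 < #|components S|.

Definition degree_in S x : nat := #|[set y | induced_adj S x y]|.

(* Degrees in S are at most #|S|, so the default value #|S| of the minimum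
   is harmless when S is nonempty, as every component is. *)
Definition min_degree S : nat :=
  \big[minn/#|S|]_(x in S) degree_in S x.

Definition vertex_cut h F : bool :=
  disconnected (~: F) && [forall C in components (~: F), h <= min_degree C].

End InducedSubgraphs.

(* None when G has no h-vertex cut. *)
Definition kappa (h : nat) (G : sgraph) : option nat :=
  if [pick F : {set G} | vertex_cut h F] is Some F0
  then Some #|[arg min_(F < F0 | vertex_cut h F) #|F|]|
  else None.

Section BalancedHypercube.
Variable n : nat.
Local Open Scope ring_scope.

(* Coordinates live in 'Z_4, so + and - are modulo 4; the exponent of -1 is the
   representative of a_0 in {0, 1, 2, 3}. *)
Definition bh_adj : rel (n.-tuple 'Z_4) := fun a b =>
  ((b`_0 == a`_0 + 1) || (b`_0 == a`_0 - 1)) &&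
  ([forall j : 'I_n, (0 < j)%N ==> (b`_j == a`_j)]
   || [exists i : 'I_n,
        [&& (0 < i)%N,
            b`_i == a`_i + (-1) ^+ (a`_0)%R &
            [forall j : 'I_n, (0 < j)%N && (j != i) ==> (b`_j == a`_j)]]]).

Lemma bh_adj_irrefl : irreflexive bh_adj.
Proof.
move=> a; rewrite /bh_adj; set c := a`_0.
suff -> : (c == c + 1) || (c == c - 1) = false by [].
by move: c; case; do 4?case=> //.
Qed.

Lemma bh_adj_sym : symmetric bh_adj.
Proof.
suff H a b : bh_adj a b -> bh_adj b a by move=> a b; apply/idP/idP; apply: H.
rewrite /bh_adj => /andP[h0 h].
have sgn : (-1) ^+ (b`_0)%R = - (-1) ^+ (a`_0)%R :> 'Z_4.
  move: h0; case: (a`_0) => [m hm]; case: (b`_0) => [k hk].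
  by move: m hm k hk; do 4?[case] => //= hm; do 4?[case] => //= hk; move=> _; apply/val_inj.
apply/andP; split.
  case/orP: h0 => /eqP->; first by rewrite addrK eqxx orbT.
  by rewrite subrK eqxx.
case/orP: h => [/forallP h | /existsP[i /and3P[i0 /eqP bi /forallP h]]].
  apply/orP; left; apply/forallP => j; apply/implyP => j0.
  by rewrite eq_sym; apply: (implyP (h j)).
apply/orP; right; apply/existsP; exists i; apply/and3P; split=> //.
  by rewrite bi sgn addrK.
by apply/forallP => j; apply/implyP => hj; rewrite eq_sym; apply: (implyP (h j)).
Qed.

Definition BH : sgraph := SGraph bh_adj_sym bh_adj_irrefl.

End BalancedHypercube.

(* Main.v *)
Require Import Defs.
From mathcomp Require Import all_boot all_order all_algebra zify.

Set Implicit Arguments.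
Unset Strict Implicit.
Unset Printing Implicit Defensive.

Import GRing.Theory.

(** The vertices (a_0, a_1, ...) and (a_0 + 2, a_1, ...) of BH_n are twins: they
    have the same neighbours.  Hence BH_n is a double cover of a quotient Q_n
    with 2 * 4^(n-1) vertices, in which only the parity of a_0 survives, and
    adjacency in BH_n is adjacency of the images.  Q_n is bipartite, n-regular
    and has no 4-cycle.

    Lower bound.  Let F be a 1-vertex cut of BH_n, and let D be the set of
    vertices of Q_n both of whose lifts lie in F, so that 2|D| <= |F|.  As no
    vertex outside F is isolated, twins outside F share a neighbour, so paths of
    Q_n - D lift ([lift_connect]) and Q_n - D must be disconnected; it has no
    isolated vertex either.  If |F| < 4n - 4 then |D| < 2n - 2, and the two
    properties are incompatible: after the deletion of fewer than
    2n - 2 vertices, all vertices of Q_n but at most one lie in one component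
    ([quotient_almost_connected]).

    The last fact is proved along with the n-connectedness of Q_n by induction
    on n ([ext_exceptional]).  Q_(n+1) consists of four layers isomorphic to
    Q_n, in cyclic order, and each vertex has exactly one neighbour outside its
    layer.  Delete a set D with |D| <= 2n - 1, and let k be the layer that loses
    most vertices.  Each other layer loses fewer than n vertices, so stays
    connected, and these three layers are linked to each other because there are
    more edges between two layers than deleted vertices.  If a vertex v of layer
    k is cut off from them, then each z in the closed neighbourhood of v inside
    the layer is in D or has its outer neighbour in D; these are distinct
    elements of D, so |D| >= n + 1.  Two such vertices v would give |D| >= 2n,
    as the union of two closed neighbourhoods has at least 2n elements in an
    n-regular bipartite graph without 4-cycles.

    Upper bound.  The lift of the set of neighbours of an edge uv of Q_n has
    4n - 4 elements and separates the four lifts of u and v, which form a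
    4-cycle.  Any other remaining vertex of Q_n shares at most one neighbour
    with u or v, so it keeps a neighbour, whose two lifts give degree 2
    ([cover_cut]). *)

(** * Deleting vertices; signs and shifts modulo 4 *)

Definition del (T : finType) (e : rel T) (D : {set T}) : rel T :=
  [rel x y | [&& x \notin D, y \notin D & e x y]].

Lemma del_sym (T : finType) (e : rel T) (D : {set T}) :
  symmetric e -> symmetric (del e D).
Proof. by move=> es x y; rewrite /del /= es andbCA. Qed.

Lemma connect_del_sym (T : finType) (e : rel T) (D : {set T}) :
  symmetric e -> connect_sym (del e D).
Proof. by move=> es; apply: sym_connect_sym; apply: del_sym. Qed.

Lemma Z4_sign_neq0 (b : bool) : ((-1) ^+ b != 0 :> 'Z_4)%R.
Proof. by case: b. Qed.

Lemma Z4_sign_double (b c : bool) :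
  ((-1) ^+ b + (-1) ^+ c = 0 :> 'Z_4)%R -> c = ~~ b.
Proof. by case: b; case: c. Qed.

Lemma Z4_shift (k j : 'Z_4) :
  j != k -> [\/ j = k + 1, j = k + 1 + 1 | j = k + 1 + 1 + 1]%R.
Proof.
move: k j; do 2![case; do 4?[case] => //= ?] => // _;
by [apply: Or31; apply/val_inj | apply: Or32; apply/val_inj
   | apply: Or33; apply/val_inj].
Qed.

Lemma Z4_shift_neq (k : 'Z_4) :
  [/\ k + 1 != k, k + 1 + 1 != k & k + 1 + 1 + 1 != k]%R.
Proof. by case: k; do 4?[case] => // ?; split. Qed.

(** * Bipartite graphs without 4-cycles, with a matching of the two sides *)

(** The graphs on which the extension below can be iterated.  The bijection
    [mate] between the sides tells where the edges that leave a layer arrive;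
    it need not map a vertex to a neighbour. *)
Record matched := Matched {
  site :> finType;
  link : rel site;
  side : site -> bool;
  mate : site -> site;
  link_sym : symmetric link;
  link_side : forall x y, link x y -> side y = ~~ side x;
  side_mate : forall x, side (mate x) = ~~ side x;
  mateK : involutive mate;
  link_c4free : forall a b c d,
    link a b -> link b c -> link c d -> link d a -> a = c \/ b = d
}.

Section Nbhd.
Variable G : matched.
Implicit Types x y : G.

Definition nbhd x : {set G} := [set y | link x y].

Lemma link_irr x : link x x = false.
Proof. by apply/negP => /link_side; case: (side x). Qed.

Lemma card_common x y : x != y -> #|nbhd x :&: nbhd y| <= 1.
Proof.
move=> xy; apply/card_le1_eqP => a b.
rewrite !inE => /andP[xa ya] /andP[xb yb].
case: (@link_c4free G x a y b) => //; rewrite 1?link_sym //.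
by move=> exy; rewrite exy eqxx in xy.
Qed.

Lemma card_closed_nbhd x : #|x |: nbhd x| = #|nbhd x|.+1.
Proof. by rewrite cardsU1 inE link_irr. Qed.

(** Two closed neighbourhoods share at most two vertices: the ends x, y if these
    are adjacent (a common neighbour would be on neither side), and otherwise
    only common neighbours. *)
Lemma card_closed_nbhd2 n x y :
  (forall z, #|nbhd z| = n) -> x != y ->
  n.*2 <= #|(x |: nbhd x) :|: (y |: nbhd y)|.
Proof.
move=> deg xy; rewrite cardsU !card_closed_nbhd !deg.
suff: #|(x |: nbhd x) :&: (y |: nbhd y)| <= 2 by lia.
have [lxy|nlxy] := boolP (link x y).
  apply: leq_trans (_ : #|[set x; y]| <= 2); last by rewrite cards2; case: eqP.
  apply/subset_leq_card/subsetP => z; rewrite !inE => /andP[/orP[->//|xz]].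
  case/orP=> [->|yz]; first by rewrite orbT.
  by move: (link_side yz); rewrite (link_side xz) (link_side lxy); case: side.
apply: leq_trans (leq_trans (card_common xy) _) => //.
apply/subset_leq_card/subsetP => z; rewrite !inE.
case/andP=> /orP[/eqP->|xz] /orP[/eqP|yz].
- by move=> exy; rewrite exy eqxx in xy.
- by rewrite link_sym yz in nlxy.
- by move=> ezy; rewrite -ezy xz in nlxy.
- by rewrite xz yz.
Qed.

End Nbhd.

(** * Four layers in a cycle *)

Section Extension.
Variable G : matched.
Local Open Scope ring_scope.
Notation T := ('Z_4 * G)%type.
Implicit Types x y : T.

(** The neighbour of x outside its layer.  The sign depends on the side, which
    makes [cross] an involution, so that it defines undirected edges. *)
Definition cross x : T := (x.1 + (-1) ^+ side x.2, mate x.2).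
Definition ext_link : rel T :=
  fun x y => (x.1 == y.1) && link x.2 y.2 || (y == cross x).
Definition ext_side x := side x.2.
Definition ext_mate x : T := (x.1, mate x.2).

Lemma crossK : involutive cross.
Proof.
case=> k v; rewrite /cross /= mateK side_mate; congr pair.
by case: (side v); rewrite /= ?expr0 ?expr1 ?addrK ?subrK.
Qed.

Lemma cross_layer x : (cross x).1 != x.1.
Proof. by rewrite /= -subr_eq0 addrC addKr Z4_sign_neq0. Qed.

Lemma ext_link_sym : symmetric ext_link.
Proof.
move=> x y; rewrite /ext_link eq_sym link_sym; congr (_ || _).
by apply/eqP/eqP => ->; rewrite crossK.
Qed.

Lemma ext_link_side x y : ext_link x y -> ext_side y = ~~ ext_side x.
Proof. by case/orP => [/andP[_ /link_side]|/eqP->] //; rewrite /ext_side side_mate. Qed.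

Lemma ext_side_mate x : ext_side (ext_mate x) = ~~ ext_side x.
Proof. exact: side_mate. Qed.

Lemma ext_mateK : involutive ext_mate.
Proof. by case=> k v; rewrite /ext_mate mateK. Qed.

(** Since [cross] is an involution, a 4-cycle with a <> c and b <> d has no two
    consecutive crossing edges.  With one crossing edge it would not return to
    its layer.  Two opposite ones, met in the order of the cycle, leave from
    vertices on the same side, so they move by the same sign and do not return
    to the first layer modulo 4 either. *)
Lemma ext_c4free a b c d :
  ext_link a b -> ext_link b c -> ext_link c d -> ext_link d a -> a = c \/ b = d.
Proof.
move=> ab bc cd da.
have same_ac: ext_side c = ext_side a.
  by rewrite (ext_link_side bc) (ext_link_side ab) negbK.
have same_bd: ext_side d = ext_side b.
  by rewrite (ext_link_side cd) (ext_link_side bc) negbK.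
have layer x y : (x.1 == y.1) && link x.2 y.2 -> y.1 = x.1.
  by case/andP=> /eqP.
(* y = cross x and t = cross z are the two opposite crossing edges. *)
have two x y z t : y = cross x -> z.1 = y.1 -> t = cross z -> t.1 = x.1 ->
    ext_side z = ext_side x -> False.
  move=> -> zx ->; rewrite /= zx /= -addrA -{2}[x.1]addr0 => /addrI.
  by rewrite /ext_side => /Z4_sign_double->; case: side.
have one x y : y = cross x -> y.1 = x.1 -> False.
  by move=> -> /eqP; rewrite (negPf (cross_layer x)).
case/orP: ab => [ab|/eqP ab]; case/orP: bc => [bc|/eqP bc];
  case/orP: cd => [cd|/eqP cd]; case/orP: da => [da|/eqP da].
- case: a b c d ab bc cd da {same_ac same_bd} => [k1 a] [k2 b] [k3 c] [k4 d] /=.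
  move=> /andP[/eqP <- ab] /andP[/eqP <- bc] /andP[/eqP<- cd] /andP[_ da].
  by case: (link_c4free ab bc cd da) => ->; [left|right].
- by case: (one _ _ da); rewrite (layer _ _ cd) (layer _ _ bc) (layer _ _ ab).
- by case: (one _ _ cd); rewrite -(layer _ _ da) (layer _ _ bc) (layer _ _ ab).
- by left; rewrite da cd crossK.
- by case: (one _ _ bc); rewrite -(layer _ _ cd) -(layer _ _ da) -(layer _ _ ab).
- by case: (two _ _ _ _ bc (layer _ _ cd) da _ same_bd); rewrite (layer _ _ ab).
- by right; rewrite cd bc crossK.
- by right; rewrite cd bc crossK.
- by case: (one _ _ ab); rewrite -(layer _ _ bc) -(layer _ _ cd) -(layer _ _ da).
- by right; rewrite ab da crossK.
- by case: (two _ _ _ _ ab (layer _ _ bc) cd _ same_ac); rewrite (layer _ _ da).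
- by left; rewrite da cd crossK.
- by left; rewrite bc ab crossK.
- by left; rewrite bc ab crossK.
- by left; rewrite bc ab crossK.
- by left; rewrite bc ab crossK.
Qed.

Definition extension : matched :=
  Matched ext_link_sym ext_link_side ext_side_mate ext_mateK ext_c4free.

End Extension.

(** * Deleting vertices from four layers *)

Definition regular n (G : matched) := forall x : G, #|nbhd x| = n.

Definition robust n (G : matched) :=
  forall (D : {set G}) x y, #|D| < n -> x \notin D -> y \notin D ->
  connect (del (@link G) D) x y.

(** The bound ensures that fewer than 2n - 1 deletions leave an edge between any
    two consecutive layers of the extension. *)
Definition roomy n (G : matched) := n.*2.-1 <= #|[set x : G | ~~ side x]|.

Section LayerCounting.
Variable G : matched.
Notation E := (extension G).
Implicit Types (D : {set E}) (k : 'Z_4) (v : G) (x y : E).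

Lemma ext_regular n : regular n G -> regular n.+1 E.
Proof.
move=> deg [k v]; have -> : nbhd ((k, v) : E) =
    cross ((k, v) : E) |: [set ((k, w) : E) | w in nbhd v].
  apply/setP => -[l w]; rewrite !inE orbC; congr (_ || _).
  apply/andP/imsetP => [[/eqP /= <- vw]|[u + [-> ->]]]; last by rewrite inE.
  by exists w; rewrite ?inE.
rewrite cardsU1 card_imset ?deg; last by move=> ? ? [].
case: imsetP => // -[w _ /(congr1 fst)/eqP].
by rewrite (negPf (cross_layer ((k, v) : E))).
Qed.

Lemma ext_roomy n : 0 < n -> roomy n G -> roomy n.+1 E.
Proof.
rewrite /roomy => n0 room.
have -> : [set x : E | ~~ side x] = setX [set: 'Z_4] [set v : G | ~~ side v].
  by apply/setP => -[k v]; rewrite !inE.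
rewrite cardsX cardsT card_ord (_ : (Zp_trunc 4).+2 = 4) //; move: room; lia.
Qed.

Definition slice D k : {set G} := [set v | (k, v) \in D].

(** The vertices of layer k through which no path of the remaining graph leaves
    that layer. *)
Definition blocked D k : {set G} :=
  [set v | ((k, v) \in D) || (cross ((k, v) : E) \in D)].

(** A blocked vertex is charged to itself if it is deleted, and otherwise to its
    outer neighbour; the layer of the result tells which case applied, so
    the charging is injective. *)
Lemma card_blocked D k : #|blocked D k| <= #|D|.
Proof.
pose f v : E := if (k, v) \in D then (k, v) else cross ((k, v) : E).
have layer_f v : ((f v).1 == k) = ((k, v) \in D).
  by rewrite /f; case: ifP => _; rewrite ?eqxx // (negPf (cross_layer ((k, v) : E))).
have f_inj : injective f.
  move=> v w e; have := layer_f v; rewrite e layer_f => ewv; move: e; rewrite /f -ewv.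
  by case: ifP => _ => [[]|/(can_inj (@crossK G))[]].
rewrite -(card_imset _ f_inj); apply/subset_leq_card/subsetP => _ /imsetP[v + ->].
by rewrite inE /f; case: ifP.
Qed.

Lemma card_slice D k : #|slice D k| <= #|D|.
Proof.
apply: leq_trans (card_blocked D k); apply/subset_leq_card/subsetP => v.
by rewrite !inE => ->.
Qed.

Lemma connect_slice D k v w :
  connect (del (@link G) (slice D k)) v w ->
  connect (del (@link E) D) (k, v) (k, w).
Proof.
case/connectP => p; elim: p v => [|u p IHp] v /=; first by move=> _ ->.
case/andP=> /and3P[]; rewrite !inE => vD uD vu pth lst.
apply: connect_trans (IHp u pth lst); apply: connect1.
by rewrite /del /= vD uD /link /= /ext_link eqxx vu.
Qed.

Lemma connect_cross D x :
  x \notin D -> cross x \notin D -> connect (del (@link E) D) x (cross x).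
Proof.
by move=> xD cD; apply: connect1; rewrite /del /= xD cD /= /ext_link eqxx orbT.
Qed.

Definition layer k : {set E} := [set x : E | x.1 == k].

(** Take k to be the layer with most deletions.  Another layer with n deletions
    would force 2n in total, and unless D is empty layer k contains at least one
    of its elements. *)
Lemma heaviest_layer n D : #|D| <= n.*2.-1 -> 0 < n ->
  exists k, #|D :\: layer k| < n.*2.-1 /\ forall j, j != k -> #|slice D j| < n.
Proof.
move=> leD n0.
have [k kmax] : exists k : 'Z_4, forall j : 'Z_4, #|slice D j| <= #|slice D k|.
  by case: (@arg_maxnP 'Z_4 0%R predT (fun j => #|slice D j|)) => // k _ kmax;
    exists k => j; apply: kmax.
exists k; have := cardsID (layer k) D.
have sl j : j != k -> slice D j = slice (D :\: layer k) j.
  by move=> jk; apply/setP => v; rewrite !inE jk.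
have slk : slice D k = slice (D :&: layer k) k.
  by apply/setP => v; rewrite !inE eqxx andbT.
have := card_slice (D :&: layer k) k; rewrite -slk => lek splitD.
split=> [|j jk]; last first.
  by have := kmax j; have := card_slice (D :\: layer k) j; rewrite -sl //; lia.
have [->|[[j v] jvD]] := set_0Vmem (D :\: layer k); first by rewrite cards0; lia.
have: 0 < #|slice D j|.
  by apply/card_gt0P; exists v; move: jvD; rewrite !inE => /andP[].
by have := kmax j; lia.
Qed.

(** The induction step, yielding both (n+1)-connectedness (when |D| <= n) and the
    uniqueness of the exceptional vertex (when |D| <= 2n - 1). *)
Lemma ext_exceptional n D : 0 < n -> regular n G -> robust n G -> roomy n G ->
    #|D| <= n.*2.-1 ->
  exists r : E, forall x, x \notin D -> ~~ connect (del (@link E) D) r x ->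
    n < #|D| /\ forall y, y \notin D -> ~~ connect (del (@link E) D) r y -> x = y.
Proof.
move=> n0 deg conn room leD.
have [k [ltD' light]] := heaviest_layer leD n0.
set D' := D :\: layer k in ltD'.
have csym := connect_del_sym D (@link_sym E).
have in_layer j v w : j != k -> (j, v) \notin D -> (j, w) \notin D ->
    connect (del (@link E) D) (j, v) (j, w).
  by move=> jk vD wD; apply: connect_slice; apply: conn; rewrite ?inE ?light.
(* An edge between consecutive light layers survives: the pairs formed by a
   vertex v on side [false] and [cross v] are disjoint, and by [roomy] they
   outnumber the deletions outside layer k. *)
have bridge j : j != k -> (j + 1)%R != k -> exists v w,
    [/\ (j, v) \notin D, (j + 1, w)%R \notin D &
        connect (del (@link E) D) (j, v) (j + 1, w)%R].
  move=> jk j1k; have: ~~ ([set v : G | ~~ side v] \subset blocked D' j).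
    apply/negP => /subset_leq_card; have := card_blocked D' j.
    by move: room; rewrite /roomy; lia.
  have cross_even v : ~~ side v -> cross ((j, v) : E) = (j + 1, mate v)%R.
    by move=> sv; rewrite /cross /= (negPf sv).
  case/subsetPn => v; rewrite !inE => sv; rewrite cross_even //= jk j1k.
  case/norP=> jvD cD; exists v, (mate v); split=> //.
  by rewrite -cross_even //; apply: connect_cross; rewrite ?cross_even.
have [k1 k2 k3] := Z4_shift_neq k.
have [v1 [v2 [v1D v2D c12]]] := bridge _ k1 k2.
have [w2 [w3 [w2D w3D c23]]] := bridge _ k2 k3.
pose r : E := (k + 1 + 1, v2)%R.
have good j v : j != k -> (j, v) \notin D -> connect (del (@link E) D) r (j, v).
  move=> jk jvD; case: (Z4_shift jk) => ej; move: jk jvD; rewrite ej => jk jvD.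
  - by apply: connect_trans (in_layer _ _ _ jk v1D jvD); rewrite csym.
  - exact: in_layer.
  - apply: connect_trans (in_layer _ _ _ jk w3D jvD).
    by apply: connect_trans c23; apply: in_layer.
exists r.
(* If some z in the closed neighbourhood of x were not blocked, x would be
   reached from the root through [cross z] and z. *)
have bad_blocked x : x \notin D -> ~~ connect (del (@link E) D) r x ->
    x.1 = k /\ (x.2 |: nbhd x.2) \subset blocked D k.
  case: x => j v /= jvD nrx.
  have ejk : j = k by apply/eqP/negPn/negP => jk; rewrite good in nrx.
  subst j; split=> //; apply/subsetP => z.
  rewrite !inE => zN; apply/negPn/negP => /norP[kzD cD].
  case/negP: nrx; apply: (@connect_trans _ _ ((k, z) : E)); last first.
    case/predU1P: zN => [->|vz] //; apply: connect1.
    by rewrite /del /= kzD jvD /= /ext_link eqxx link_sym vz.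
  rewrite csym; apply: connect_trans (connect_cross kzD cD) _.
  by rewrite csym; apply: good => //; apply: (cross_layer ((k, z) : E)).
move=> x xD nrx; have [xk xb] := bad_blocked _ xD nrx; split.
  move: (subset_leq_card xb); rewrite card_closed_nbhd deg => lt.
  exact: leq_trans lt (card_blocked D k).
move=> y yD nry; have [yk yb] := bad_blocked _ yD nry.
case: (x =P y) => // /eqP xy.
have xy2 : x.2 != y.2.
  apply: contra xy; case: x {xD nrx xb} xk; case: y {yD nry yb} yk => ? ? /= -> ? ? /= ->.
  by move/eqP->.
have := card_closed_nbhd2 deg xy2.
have : (x.2 |: nbhd x.2) :|: (y.2 |: nbhd y.2) \subset blocked D k by rewrite subUset xb.
move/subset_leq_card => le_blocked le_union.
have := leq_trans le_union (leq_trans le_blocked (leq_trans (card_blocked D k) leD)).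
by move: n0; clear; lia.
Qed.

Lemma ext_robust n : 0 < n -> regular n G -> robust n G -> roomy n G -> robust n.+1 E.
Proof.
move=> n0 deg conn room D x y ltD xD yD.
have [|r bad] := @ext_exceptional n D n0 deg conn room; first by lia.
have good z : z \notin D -> connect (del (@link E) D) r z.
  by move=> zD; apply/negPn/negP => /(bad _ zD) [] ; lia.
by apply: connect_trans (good y yD); rewrite (connect_del_sym D (@link_sym E)) good.
Qed.

End LayerCounting.

(** * The twin quotient of the balanced hypercube *)

Lemma bool_link_sym : symmetric (fun b c : bool => c == ~~ b).
Proof. by do 2!case. Qed.
Lemma bool_link_side (b c : bool) : c == ~~ b -> c = ~~ b.
Proof. by move/eqP. Qed.
Lemma bool_c4free (a b c d : bool) :
  b == ~~ a -> c == ~~ b -> d == ~~ c -> a == ~~ d -> a = c \/ b = d.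
Proof. by case: a; case: b; case: c; case: d; auto. Qed.

Definition edge_graph : matched :=
  @Matched bool _ id negb bool_link_sym bool_link_side (fun=> erefl) negbK bool_c4free.

(** The quotient of BH_(m+1): the innermost boolean is the parity of a_0, and the
    extensions add the coordinates a_1, ..., a_m. *)
Definition quotient_graph m : matched := iter m extension edge_graph.

Lemma quotient_spec m :
  [/\ regular m.+1 (quotient_graph m), robust m.+1 (quotient_graph m)
    & roomy m.+1 (quotient_graph m)].
Proof.
elim: m => [|m [deg conn room]]; last first.
  by split; [apply: ext_regular | apply: ext_robust | apply: ext_roomy].
split.
- move=> x; rewrite -(cards1 (~~ x)); congr #|pred_of_set _|.
  by apply/setP => y; rewrite !inE.
- move=> D x y; rewrite ltnS leqn0 cards_eq0 => /eqP-> _ _.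
  case: (x =P y) => [->|/eqP xy]; first exact: connect0.
  by apply: connect1; rewrite /del /= !inE; case: x y xy => [] [].
- by apply/card_gt0P; exists (false : edge_graph); rewrite inE.
Qed.

Lemma quotient_almost_connected m (D : {set quotient_graph m}) :
  0 < m -> #|D| < m.*2 ->
  exists r, forall x y, x \notin D -> y \notin D ->
    ~~ connect (del (@link _) D) r x -> ~~ connect (del (@link _) D) r y -> x = y.
Proof.
case: m D => // m D _ ltD; have [deg conn room] := quotient_spec m.
have [|r bad] := @ext_exceptional _ m.+1 D (ltn0Sn m) deg conn room; first exact: ltD.
by exists r => x y xD yD nx ny; case: (bad x xD nx) => _; apply.
Qed.

(** * Vertex cuts without components *)

Section Cuts.
Variable G : sgraph.
Implicit Types (S C F : {set G}) (h : nat).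

Lemma induced_equiv S : {in S & &, equivalence_rel (connect (induced_adj S))}.
Proof.
move=> x y z _ _ _; split; first exact: connect0.
suff csym : connect_sym (induced_adj S) by move/(same_connect csym).
by apply: sym_connect_sym => a b; rewrite /induced_adj /= adj_sym andbCA.
Qed.

Lemma mem_component S x y : x \in S -> y \in S ->
  (y \in pblock (components S) x) = connect (induced_adj S) x y.
Proof. exact: pblock_equivalence_partition (@induced_equiv S) _ _. Qed.

Lemma components_partition S : partition (components S) S.
Proof. exact: equivalence_partitionP (@induced_equiv S). Qed.

Lemma component_pblock S C x : C \in components S -> x \in C ->
  pblock (components S) x = C.
Proof. by case/and3P: (components_partition S) => _ tI _; apply: def_pblock. Qed.

Lemma component_sub S C : C \in components S -> C \subset S.
Proof.
by case/and3P: (components_partition S) => /eqP cov _ _ CS; rewrite -cov (bigcup_sup C).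
Qed.

Lemma pblock_component S x : x \in S ->
  (pblock (components S) x \in components S) * (x \in pblock (components S) x).
Proof.
case/and3P: (components_partition S) => /eqP cov _ _.
by rewrite -{1}cov => xS; rewrite pblock_mem // mem_pblock.
Qed.

Lemma disconnectedP S : reflect
  (exists x y, [/\ x \in S, y \in S & ~~ connect (induced_adj S) x y]) (disconnected S).
Proof.
apply: (iffP idP) => [/card_gt1P[C [C' [CS C'S CC']]]|[x [y [xS yS nxy]]]].
  have ne B : B \in components S -> exists x, x \in B.
    case/and3P: (components_partition S) => _ _ n0 BS; apply/set0Pn.
    by apply: contraNneq n0 => <-.
  have [[x xC] [y yC]] := (ne _ CS, ne _ C'S).
  have xS := subsetP (component_sub CS) x xC.
  have yS := subsetP (component_sub C'S) y yC.
  exists x, y; split=> //; rewrite -mem_component // (component_pblock CS xC).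
  apply: contra CC' => yC1; rewrite -(component_pblock CS yC1).
  by rewrite (component_pblock C'S yC).
apply/card_gt1P; exists (pblock (components S) x), (pblock (components S) y).
rewrite !pblock_component //; split=> //; apply: contra nxy => /eqP e.
by rewrite -mem_component // e pblock_component.
Qed.

Lemma degree_component S C x :
  C \in components S -> x \in C -> degree_in C x = degree_in S x.
Proof.
move=> CS xC; have xS := subsetP (component_sub CS) x xC.
congr #|pred_of_set _|; apply/setP => y; rewrite !inE /induced_adj /= xC xS /=.
have [yS|yS] := boolP (y \in S); last first.
  by rewrite (contraNF (subsetP (component_sub CS) y) yS).
have [xy|_] := boolP (adj x y); last by rewrite !andbF.
rewrite -(component_pblock CS xC) mem_component // connect1 //.
by rewrite /induced_adj /= xS yS.
Qed.

Lemma min_degree_geP h C x : x \in C ->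
  reflect {in C, forall y, h <= degree_in C y} (h <= min_degree C).
Proof.
move=> xC; have minE y : y \in C -> min_degree C <= degree_in C y.
  move=> yC; rewrite /min_degree; have := mem_index_enum y.
  elim: (index_enum _) => // z s IHs; rewrite inE big_cons.
  case/predU1P => [<-|/IHs les]; first by rewrite yC geq_minl.
  by case: ifP => // _; rewrite geq_min les orbT.
apply: (iffP idP) => [le y yC|le]; first exact: leq_trans le (minE y yC).
have hC : h <= #|C|.
  apply: leq_trans (le x xC) _; apply/subset_leq_card/subsetP => y.
  by rewrite inE => /and3P[].
by rewrite /min_degree; elim/big_ind: _ => // a b ha hb; rewrite leq_min ha.
Qed.

(** A vertex has the same degree in its component as in the whole of G - F, so
    the condition on components is a condition on vertices. *)
Lemma vertex_cutP h F : reflect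
  (disconnected (~: F) /\ forall x, x \notin F -> h <= degree_in (~: F) x)
  (vertex_cut h F).
Proof.
apply: (iffP andP) => -[dis deg]; split=> //.
  move=> x; rewrite -in_setC => xF; have [CS xC] := pblock_component xF.
  rewrite -(degree_component CS xC); apply: (min_degree_geP h xC _) => //.
  by move/forall_inP: deg; apply.
apply/forall_inP => C CS; have [C0|[x xC]] := set_0Vmem C.
  by case/and3P: (components_partition (~: F)) => _ _ /negP[]; rewrite -C0.
apply/(min_degree_geP h xC) => y yC; rewrite (degree_component CS yC) deg //.
by rewrite -in_setC (subsetP (component_sub CS)).
Qed.

Lemma kappa_eq h k F : vertex_cut h F -> #|F| <= k ->
  (forall F', vertex_cut h F' -> k <= #|F'|) -> kappa h G = Some k.
Proof.
move=> Fcut leF minF; rewrite /kappa; case: pickP => [F0 F0cut|/(_ F)]; last first.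
  by rewrite Fcut.
case: arg_minnP => // F1 F1cut F1min; congr Some; apply/eqP.
by rewrite eqn_leq minF // andbT (leq_trans (F1min F Fcut)).
Qed.

End Cuts.

(** * Vertex cuts of a double cover *)

Section DoubleCover.
Variables (G : sgraph) (H : matched) (q : G -> H).
Hypothesis adj_q : forall x y, adj x y = link (q x) (q y).
Hypothesis fibre2 : forall h, #|q @^-1: [set h]| = 2.

Lemma card_preimage (D : {set H}) : #|q @^-1: D| = #|D|.*2.
Proof.
rewrite -sum1_card (partition_big q (fun h => h \in D)) => [|x]; last by rewrite inE.
rewrite -muln2 -sum_nat_const; apply: eq_bigr => h hD.
rewrite -(fibre2 h) -sum1_card; apply: eq_bigl => x; rewrite !inE.
by case: eqP => [->|]; rewrite ?andbF // hD.
Qed.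

Lemma fibre_mem h : exists x, q x = h.
Proof.
have /card_gt0P[x] : 0 < #|q @^-1: [set h]| by rewrite fibre2.
by rewrite !inE => /eqP <-; exists x.
Qed.

(** The vertices that disappear from the quotient when F is deleted above. *)
Definition full_fibres (F : {set G}) : {set H} := [set h | q @^-1: [set h] \subset F].

Lemma notin_full_fibres (F : {set G}) h :
  h \notin full_fibres F -> exists2 x, x \notin F & q x = h.
Proof.
by rewrite inE => /subsetPn[x]; rewrite !inE => /eqP qx xF; exists x.
Qed.

Lemma q_notin_full_fibres (F : {set G}) x : x \notin F -> q x \notin full_fibres F.
Proof. by rewrite inE; apply: contra => /subsetP; apply; rewrite !inE. Qed.

(** Each inner vertex of the path below has a lift outside F.  The neighbour y
    of x is needed when the path has length 0: then w may be the twin of x, and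
    the two are joined through y. *)
Lemma lift_connect (F : {set G}) x y w :
  x \notin F -> y \notin F -> adj x y ->
  connect (del (@link H) (full_fibres F)) (q x) (q w) -> w \notin F ->
  connect (induced_adj (~: F)) x w.
Proof.
move=> xF yF xy /connectP[p pth lst] wF.
have step a b : a \notin F -> b \notin F -> adj a b -> induced_adj (~: F) a b.
  by move=> aF bF ab; rewrite /induced_adj /= !inE aF bF.
elim/last_ind: p w wF pth lst => [|p h IHp] w wF /=.
  move=> _ ew; apply: (@connect_trans _ _ y); apply/connect1/step => //.
  by rewrite adj_sym adj_q ew -adj_q.
rewrite rcons_path last_rcons => /andP[pth] /and3P[lF hF lh] ew.
have [a aF qa] := notin_full_fibres lF.
apply: connect_trans (IHp a aF pth qa) _; apply/connect1/step => //.
by rewrite adj_q qa ew.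
Qed.

(** A vertex z outside F has a neighbour y outside F.  If the image of z is not
    reached from r, neither is that of y, although the two are distinct: this
    contradicts the uniqueness of the exceptional vertex. *)
Lemma cover_lower_bound k (F : {set G}) :
  (forall D : {set H}, #|D| < k -> exists r, forall x y,
     x \notin D -> y \notin D -> ~~ connect (del (@link H) D) r x ->
     ~~ connect (del (@link H) D) r y -> x = y) ->
  vertex_cut 1 F -> k.*2 <= #|F|.
Proof.
move=> almost /vertex_cutP[/disconnectedP[x [w []]]].
rewrite !inE => xF wF /negP nxw deg; rewrite leqNgt; apply/negP => ltF; apply: nxw.
set D := full_fibres F.
have leD : #|D|.*2 <= #|F|.
  rewrite -card_preimage; apply/subset_leq_card/subsetP => z; rewrite inE.
  by apply: contraLR; apply: q_notin_full_fibres.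
have [|r sing] := almost D; first by lia.
have nbr z : z \notin F -> exists2 y, y \notin F & adj z y.
  move=> zF; case/card_gt0P: (deg z zF) => y.
  rewrite inE /induced_adj /= !inE => /and3P[_ yF zy].
  by exists y.
have csym := connect_del_sym D (@link_sym H).
have reach z : z \notin F -> connect (del (@link H) D) r (q z).
  move=> zF; have [y yF zy] := nbr z zF.
  have [qzD qyD] := (q_notin_full_fibres zF, q_notin_full_fibres yF).
  have lzy : connect (del (@link H) D) (q z) (q y).
    by apply: connect1; rewrite /del /= qzD qyD -adj_q.
  apply/negPn/negP => nz; have := sing _ _ qzD qyD nz.
  rewrite (contra _ nz) => [/(_ isT) e|ry]; last first.
    by apply: connect_trans ry _; rewrite csym.
  by move: zy; rewrite adj_q e link_irr.
have [y yF xy] := nbr x xF.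
apply: (lift_connect xF yF xy) => //.
by apply: connect_trans (reach w wF); rewrite csym reach.
Qed.

Definition edge_nbhd (u v : H) : {set H} := (nbhd u :\ v) :|: (nbhd v :\ u).

Lemma edge_nbhdC u v : edge_nbhd u v = edge_nbhd v u.
Proof. exact: setUC. Qed.

Lemma card_edge_nbhd n (u v : H) : regular n.+1 H -> link u v ->
  #|edge_nbhd u v| <= n.*2.
Proof.
move=> deg uv; apply: leq_trans (leq_card_setU _ _) _.
have := cardsD1 v (nbhd u); have := cardsD1 u (nbhd v).
by rewrite !deg !inE uv link_sym uv; lia.
Qed.

(** A vertex p other than u and v meets this set only in neighbours of the end on
    its own side, and it shares at most one neighbour with that end. *)
Lemma escape_edge_nbhd n (u v p : H) : regular n H -> 1 < n -> link u v ->
  exists2 z, link p z & z \notin edge_nbhd u v.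
Proof.
move=> deg n1.
suff same_side a b : link a b -> side p = side a ->
    exists2 z, link p z & z \notin edge_nbhd a b.
  move=> uv; have := link_side uv; case: (side p =P side u) => [|/eqP ne suv].
    by move=> + _; apply: same_side.
  rewrite edge_nbhdC; apply: same_side; first by rewrite link_sym.
  by rewrite suv; move: ne; do 2!case: side.
move=> ab sp; have [->|pa] := eqVneq p a.
  by exists b => //; rewrite !inE eqxx link_irr andbF.
suff /subsetPn[z] : ~~ (nbhd p \subset nbhd a).
  rewrite !inE => pz az; exists z => //; rewrite !inE (negPf az) andbF /=.
  apply/negP => /andP[_ bz]; move: (link_side pz).
  by rewrite (link_side bz) (link_side ab) sp; case: side.
apply/negP => /setIidPl e; have := card_common pa.
by rewrite e deg; lia.
Qed.

(** The deleted set is the lift of the neighbourhood of an edge uv.  The other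
    remaining vertex w is found by counting on the side of u, where only the
    neighbours of v are excluded. *)
Lemma cover_cut n : 0 < n -> regular n.+1 H -> roomy n.+1 H ->
  exists2 F : {set G}, vertex_cut 2 F & #|F| <= n.*2.*2.
Proof.
move=> n0 deg room.
have /card_gt0P[u] : 0 < #|[set x : H | ~~ side x]| by move: room; rewrite /roomy; lia.
rewrite inE => su.
have /card_gt0P[v] : 0 < #|nbhd u| by rewrite deg.
rewrite inE => uv; have vu : link v u by rewrite link_sym.
have sv : side v by rewrite (link_side uv).
pose N := edge_nbhd u v.
have NF x : (x \notin q @^-1: N) = (q x \notin N) by rewrite inE.
exists (q @^-1: N); last by rewrite card_preimage leq_double card_edge_nbhd.
apply/vertex_cutP; split; last first.
  move=> x; rewrite NF => xN; have [//|z xz zN] := escape_edge_nbhd (q x) deg _ uv.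
  rewrite -(fibre2 z); apply/subset_leq_card/subsetP => y.
  rewrite [y \in _ @^-1: _]inE in_set1 => /eqP qy.
  by rewrite inE /induced_adj /= !in_setC !NF adj_q qy xz zN xN.
have /subsetPn[w] : ~~ ([set x : H | ~~ side x] \subset nbhd v).
  apply/negP => /subset_leq_card; rewrite deg.
  by move: room; rewrite /roomy; lia.
rewrite !inE => sw vw.
have wN : w \notin N.
  rewrite !inE (negPf vw) andbF orbF; apply/negP => /andP[_ /link_side].
  by rewrite (negPf su) (negPf sw).
have [[x qx] [y qy]] := (fibre_mem u, fibre_mem w).
apply/disconnectedP; exists x, y; rewrite !in_setC !NF qx qy; split=> //.
  by rewrite !inE eqxx link_irr andbF.
have cl : closed (induced_adj (~: (q @^-1: N))) [pred z | q z \in [set u; v]].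
  move=> a b; rewrite /induced_adj /= !in_setC !NF adj_q => /and3P[aN bN ab].
  have stay c d : link c d -> d \notin N -> c \in [set u; v] -> d \in [set u; v].
    move=> cd dN; rewrite !inE => /orP[]/eqP e; move: dN cd; rewrite e !inE negb_or.
    - by move=> /andP[+ _] cd; rewrite cd andbT negbK => ->; rewrite orbT.
    - by move=> /andP[_ +] cd; rewrite cd andbT negbK => ->.
  by apply/idP/idP; apply: stay; rewrite // link_sym.
apply/negP => /(closed_connect cl); rewrite !inE qx qy eqxx /=.
case: (w =P u) => [ewu|_]; first by rewrite ewu vu in vw.
by case: (w =P v) => // ewv; rewrite ewv sv in sw.
Qed.

End DoubleCover.

(** * The balanced hypercube covers its quotient *)

Fixpoint collapse m (s : seq 'Z_4) (b : bool) : quotient_graph m :=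
  match m return quotient_graph m with
  | 0 => b
  | p.+1 => ((s`_0)%R, collapse p (behead s) b)
  end.

Lemma side_collapse m s b : side (collapse m s b) = b.
Proof. by elim: m s => // m IHm s; apply: IHm. Qed.

Lemma mate_collapse m s b : mate (collapse m s b) = collapse m s (~~ b).
Proof. by elim: m s => // m IHm s; congr pair; apply: IHm. Qed.

Lemma all_ltnS m (P : nat -> Prop) :
  (forall j, j < m.+1 -> P j) <-> P 0 /\ forall j, j < m -> P j.+1.
Proof.
split=> [h|[h0 h] [|j] //]; last exact: h.
by split=> [|j jm]; apply: h.
Qed.

Lemma collapse_inj m s t b c : collapse m s b = collapse m t c <->
  b = c /\ forall j, j < m -> (s`_j = t`_j)%R.
Proof.
elim: m s t => [|m IHm] s t; first by split=> [//|[]].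
rewrite all_ltnS; split=> [[e0 /IHm[-> e]]|[ebc [e0 e]]].
  by split=> //; split=> // j /e; rewrite !nth_behead.
rewrite /= e0 (proj2 (IHm (behead s) (behead t))) //.
by split=> // j; rewrite !nth_behead; apply: e.
Qed.

Lemma link_collapse m s t b c : link (collapse m s b) (collapse m t c) <->
  c = ~~ b /\ ((forall j, j < m -> (t`_j = s`_j)%R) \/
    exists i, [/\ i < m, (t`_i = s`_i + (-1) ^+ b)%R &
      forall j, j < m -> j <> i -> (t`_j = s`_j)%R]).
Proof.
elim: m s t => [|m IHm] s t.
  split=> [/= /eqP -> | [-> _] /=]; last exact: eqxx.
  by split=> //; left.
have -> : link (collapse m.+1 s b) (collapse m.+1 t c) =
    (s`_0 == t`_0)%R && link (collapse m (behead s) b) (collapse m (behead t) c)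
    || (collapse m.+1 t c == (s`_0 + (-1) ^+ b, collapse m (behead s) (~~ b)))%R.
  by rewrite /= /ext_link /cross /= side_collapse mate_collapse.
split.
  case/orP=> [/andP[/eqP e0 /IHm[-> h]]|/eqP[t0 /collapse_inj[-> h]]]; split=> //.
    case: h => [h|[i [im ti h]]]; [left|right].
      by apply/all_ltnS; split=> // j; move/h; rewrite !nth_behead.
    exists i.+1; rewrite -!nth_behead; split=> //; apply/all_ltnS; split=> // j jm ji.
    by have := h j jm; rewrite !nth_behead; apply; congruence.
  right; exists 0; split=> //; apply/all_ltnS; split=> // j jm _.
  by have := h j jm; rewrite !nth_behead.
case=> ec [/all_ltnS[e0 h]|[[|i] [im ti /all_ltnS[e0 h]]]]; apply/orP.
- left; rewrite e0 eqxx; apply/IHm; split=> //; left=> j; rewrite !nth_behead; exact: h.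
- right; rewrite -ti; apply/eqP; congr pair; apply/collapse_inj; split=> // j jm.
  by rewrite !nth_behead h.
- left; rewrite e0 // eqxx; apply/IHm; split=> //; right; exists i.
  rewrite !nth_behead; split=> // j jm ji; rewrite !nth_behead; apply: h => //.
  by case.
Qed.

Lemma collapse_surj m (h : quotient_graph m) :
  exists s : m.-tuple 'Z_4, h = collapse m s (side h).
Proof.
elim: m h => [|m IHm] h; first by exists [tuple].
case: h => k v; have [s ev] := IHm v; exists [tuple of k :: s] => //.
by congr pair.
Qed.

Definition twin_class m (t : m.+1.-tuple 'Z_4) : quotient_graph m :=
  collapse m (behead t) (odd (t`_0)%R).

Lemma Z4_neighbour (a b : 'Z_4) :
  ((b == a + 1) || (b == a - 1))%R = (odd b == ~~ odd a).
Proof. by move: a b; do 2![case; do 4?[case] => //= ?]. Qed.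

Lemma Z4_parity (a : 'Z_4) (b : bool) :
  (odd a == b) = (a == b%:R)%R || (a == b%:R + 2)%R.
Proof. by move: a; case; do 4?[case] => //= ?; case: b. Qed.

Lemma Z4_sign_odd (a : nat) : ((-1) ^+ a = (-1) ^+ odd a :> 'Z_4)%R.
Proof. by rewrite signr_odd. Qed.

Lemma bh_adj_twin_class m (a b : m.+1.-tuple 'Z_4) :
  bh_adj a b = link (twin_class a) (twin_class b).
Proof.
pose same j := (b`_j == a`_j)%R.
have tail_same : [forall j : 'I_m.+1, (0 < j) ==> same j] <->
    forall j, j < m -> same j.+1.
  split=> [/forallP h j jm|h]; first exact: h (lift ord0 (Ordinal jm)).
  by apply/forallP => -[[|j] jm]; apply/implyP => //= _; apply: h.
have tail_same_but i : [forall j : 'I_m.+1, (0 < j) && (j != i) ==> same j] <->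
    forall j, j < m -> j.+1 <> i -> same j.+1.
  split=> [/forallP h j jm ji|h].
    have /implyP := h (lift ord0 (Ordinal jm)); apply; apply/eqP => ei.
    by case: ji; rewrite -ei.
  apply/forallP => -[[|j] jm]; apply/implyP => //= ji; apply: h => // ei.
  by case/negP: ji; apply/eqP/val_inj.
rewrite /bh_adj Z4_neighbour; apply/idP/idP.
  case/andP=> /eqP ob tails; apply/link_collapse; split=> //.
  case/orP: tails => [/tail_same h|/existsP[i /and3P[i0 /eqP bi /tail_same_but h]]];
    [left|right].
    by move=> j jm; rewrite !nth_behead; apply/eqP/h.
  case: i i0 bi h => -[//|i] im _ /= bi h.
  exists i; rewrite !nth_behead bi -Z4_sign_odd; split=> // j jm ji.
  by rewrite !nth_behead; apply/eqP/h => // -[].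
case/link_collapse=> -> tails; rewrite eqxx /=; apply/orP.
case: tails => [h|[i [im bi h]]]; [left|right].
  by apply/tail_same => j jm; apply/eqP; rewrite -!nth_behead h.
apply/existsP; exists (lift ord0 (Ordinal im)); apply/and3P; split=> //=.
  by rewrite /bump /= -!nth_behead bi -Z4_sign_odd.
apply/tail_same_but => j jm ji; apply/eqP; rewrite -!nth_behead h // => eji.
by rewrite eji in ji; apply: ji.
Qed.

(** The two elements of a fibre are the two values of a_0 of a given parity. *)
Lemma twin_class_fibre m (h : quotient_graph m) :
  #|@twin_class m @^-1: [set h]| = 2.
Proof.
have [s eh] := collapse_surj h; set b := side h in eh.
pose t c := [tuple of c :: s] : m.+1.-tuple 'Z_4.
have -> : @twin_class m @^-1: [set h] = [set t b%:R; t (b%:R + 2)]%R.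
  apply/setP => a; rewrite !inE eh; case/tupleP: a => a0 a.
  have eqt c : ([tuple of a0 :: a] == t c) = (a0 == c) && (a == s).
    by rewrite -!val_eqE /= eqseq_cons.
  rewrite !eqt -andb_orl -Z4_parity; apply/eqP/andP => [/collapse_inj[-> e]|[/eqP ob /eqP->]].
    split=> //; apply/eqP/eq_from_tnth => j; rewrite !(tnth_nth 0%R).
    exact: e.
  by rewrite /twin_class /= ob.
rewrite cards2 -val_eqE eqseq_cons eqxx andbT.
by case: b {eh}.
Qed.

Theorem theorem10 (n : nat) (hn : 2 <= n) :
  kappa 1 (BH n) = Some (4 * n - 4) /\ kappa 2 (BH n) = Some (4 * n - 4).
Proof.
case: n hn => [//|m]; rewrite ltnS => m0.
have [deg _ room] := quotient_spec m.
have -> : 4 * m.+1 - 4 = m.*2.*2 by lia.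
have adjE (x y : BH m.+1) : adj x y = link (twin_class x) (twin_class y).
  exact: bh_adj_twin_class.
have [F Fcut leF] := cover_cut adjE (@twin_class_fibre m) m0 deg room.
have weaken F' : vertex_cut 2 F' -> vertex_cut (G := BH m.+1) 1 F'.
  case/vertex_cutP=> dis dg; apply/vertex_cutP; split=> // x xF.
  by apply: leq_trans (dg x xF).
have lower F' : vertex_cut (G := BH m.+1) 1 F' -> m.*2.*2 <= #|F'|.
  apply: (cover_lower_bound adjE (@twin_class_fibre m)) => D ltD.
  exact: quotient_almost_connected.
split; first exact: kappa_eq (weaken F Fcut) leF lower.
by apply: (kappa_eq Fcut leF) => F' /weaken/lower.
Qed.
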